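(* For all integers $n,p\ge 0$ and all complex numbers $a,d$ with $d\neq 0$, $$S_{p,(a,d)}(n)=\frac{d^{p}}{p+1}\sum_{s=0}^{p}\binom{p+1}{s}(n+1)^{p+1-s}B_{s}\!\left(\frac{a}{d}\right).$$
   Context: For non-negative integers $n,p$ and complex numbers $a,d$ with $d\ne 0$, $S_{p,(a,d)}(n)=\sum_{s=0}^{n}(a+sd)^{p}$ (with the convention $0^0=1$). $B_n(x)$ denotes the classical Bernoulli polynomials, defined by $\frac{ze^{xz}}{e^{z}-1}=\sum_{n\ge 0}B_{n}(x)\frac{z^{n}}{n!}$. *)

(* Defs.v *)
From mathcomp Require Import all_boot all_order all_algebra.

Set Implicit Arguments.
Unset Strict Implicit.
Unset Printing Implicit Defensive.

Import Order.TTheory GRing.Theory Num.Theory.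
Local Open Scope ring_scope.

Definition arith_power_sum (F : numFieldType) (p : nat) (a d : F) (n : nat) : F :=
  \sum_(s < n.+1) (a + s%:R * d) ^+ p.

(* A formal power series in z over A is its sequence of coefficients.         *)
Definition fps (A : Type) : Type := nat -> A.

Definition fps_mul (A : nzRingType) (f g : fps A) : fps A :=
  fun n => \sum_(i < n.+1) f i * g (n - i)%N.

Definition fps_sub (A : nzRingType) (f g : fps A) : fps A :=
  fun n => f n - g n.

Definition fps_one (A : nzRingType) : fps A := fun n => (n == 0)%N%:R.

Definition fps_z (A : nzRingType) : fps A := fun n => (n == 1)%N%:R.

(* exponential generating function: \sum_n u_n z^n / n!                       *)
Definition fps_egf (F : numFieldType) (u : nat -> {poly F}) : fps {poly F} :=
  fun n => (n`!%:R)^-1 *: u n.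

(* e^(c z)                                                                    *)
Definition fps_exp (F : numFieldType) (c : {poly F}) : fps {poly F} :=
  fps_egf (fun n => c ^+ n).

(* z e^(x z) / (e^z - 1) = \sum_n B_n(x) z^n / n! in F[x][[z]], the variable  *)
(* x being 'X.  As e^z - 1 has no constant term, it is not invertible there;  *)
(* since F[x][[z]] is a domain, the quotient is expressed by multiplying out. *)
Definition bernoulli_gf (F : numFieldType) (B : nat -> {poly F}) : Prop :=
  fps_mul (fps_sub (fps_exp 1) (fps_one _)) (fps_egf B)
    =1 fps_mul (fps_z _) (fps_exp 'X).

Lemma bernoulli_gfE (F : numFieldType) (B : nat -> {poly F}) :
  bernoulli_gf B <->
  forall n, \sum_(i < n.+1) (i.+1`!%:R)^-1 *: fps_egf B (n - i)%N = fps_exp 'X n.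
Proof.
have L n : fps_mul (fps_sub (fps_exp 1) (fps_one _)) (fps_egf B) n.+1
           = \sum_(i < n.+1) (i.+1`!%:R)^-1 *: fps_egf B (n - i)%N.
  rewrite /fps_mul big_ord_recl /= {1}/fps_sub /fps_exp {1}/fps_egf /fps_one.
  rewrite fact0 invr1 scale1r expr0 subrr mul0r add0r.
  apply: eq_bigr => i _; rewrite /bump /= add1n subSS /fps_sub /fps_egf subr0.
  by rewrite expr1n -scalerAl mul1r.
have R n : fps_mul (fps_z _) (fps_exp ('X : {poly F})) n.+1 = fps_exp 'X n.
  rewrite /fps_mul big_ord_recl /fps_z mul0r add0r big_ord_recl /=.
  by rewrite mul1r subSS subn0 big1 ?addr0 // => i _; rewrite mul0r.
split=> [gfB n | gfB].
  by rewrite -L -R gfB.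
case=> [|n].
  rewrite /fps_mul !big_ord_recl !big_ord0 /fps_sub /fps_z /fps_exp /fps_egf.
  by rewrite /fps_one fact0 invr1 scale1r expr0 subrr !mul0r.
by rewrite L R gfB.
Qed.

Lemma bernoulli_gf_unique (F : numFieldType) (B B' : nat -> {poly F}) :
  bernoulli_gf B -> bernoulli_gf B' -> B =1 B'.
Proof.
move=> /bernoulli_gfE gfB /bernoulli_gfE gfB'.
suff E n : fps_egf B n = fps_egf B' n.
  move=> n; have := E n; rewrite /fps_egf; apply: scalerI.
  by rewrite invr_eq0 pnatr_eq0 -lt0n fact_gt0.
elim/ltn_ind: n => n IHn.
have := gfB n; rewrite -(gfB' n) !big_ord_recl /= subn0 (_ : 1`! = 1%N) // invr1 !scale1r.
rewrite [X in _ + X = _](eq_bigr (fun i : 'I_n =>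
  ((lift ord0 i).+1`!%:R)^-1 *: fps_egf B' (n - lift ord0 i)%N)); first exact: addIr.
by move=> i _; rewrite IHn // /bump /= add1n ltn_subrL /= (leq_trans _ (ltn_ord i)).
Qed.

Lemma bernoulli_gf_exists (F : numFieldType) :
  {B : nat -> {poly F} | bernoulli_gf B}.
Proof.
pose step (s : seq {poly F}) : {poly F} := fps_exp 'X (size s) -
  \sum_(i < size s) (i.+2`!%:R)^-1 *: s`_(size s - i.+1).
pose bs n := iter n (fun s => rcons s (step s)) [::].
have sz n : size (bs n) = n by elim: n => //= n IHn; rewrite size_rcons IHn.
pose b n := (bs n.+1)`_n.
have bsE n i : (i < n)%N -> (bs n)`_i = b i.
  elim: n => // n IHn; rewrite ltnS leq_eqVlt => /predU1P[-> // | lt_in].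
  by rewrite /= nth_rcons sz lt_in IHn.
exists (fun n => n`!%:R *: b n); apply/bernoulli_gfE => n.
have E m : fps_egf (fun n => n`!%:R *: b n) m = b m.
  by rewrite /fps_egf scalerA mulVf ?scale1r // pnatr_eq0 -lt0n fact_gt0.
under eq_bigr do rewrite E.
rewrite big_ord_recl /= subn0 (_ : 1`! = 1%N) // invr1 scale1r {1}/b /= nth_rcons sz ltnn eqxx.
rewrite /step sz -[RHS](subrK (\sum_(i < n) (i.+2`!%:R)^-1 *: (bs n)`_(n - i.+1))).
congr (_ + _); apply: eq_bigr => i _; rewrite /bump /= add1n bsE //.
by rewrite ltn_subrL (leq_trans _ (ltn_ord i)).
Qed.

Definition bernoulli (F : numFieldType) : nat -> {poly F} :=
  sval (bernoulli_gf_exists F).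

Lemma bernoulliP (F : numFieldType) : bernoulli_gf (@bernoulli F).
Proof. exact: svalP (bernoulli_gf_exists F). Qed.

(* Main.v *)
(* Umbral calculus: let [L] be the linear functional sending ['X^i] to B_i(x).
   The generating function says [L (('X + 1)^m) = L ('X^m) + m x^(m-1)], hence
   by linearity [L (q('X + 1)) = L q + q'(x)] for every polynomial [q].  Taking
   [q = ('X + s)^(p+1)] and summing over [s <= n] telescopes to
   [L (('X + n + 1)^(p+1)) - L ('X^(p+1)) = (p+1) \sum_s (x + s)^p], whose left
   side is expanded by the binomial formula; finally [x = a / d]. *)

Require Import Defs.
From HB Require Import structures.
From mathcomp Require Import all_boot all_order all_algebra.
From mathcomp Require Import reals complex.
Import Order.TTheory GRing.Theory Num.Theory.
Local Open Scope ring_scope.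
Local Open Scope complex_scope.

(* Truncated at degree [M], so that linearity is immediate. *)
Definition umbral {R : comNzRingType} (b : nat -> R) (M : nat) (q : {poly R}) : R :=
  \sum_(i < M) q`_i * b i.

Section Umbral.
Context {R : comNzRingType} (b : nat -> R) (M : nat).

Fact umbral_is_scalar : scalar (umbral b M).
Proof.
move=> c q r; rewrite /umbral mulr_sumr -big_split /=.
by apply: eq_bigr => i _; rewrite coefD coefZ mulrDl mulrA.
Qed.

HB.instance Definition _ :=
  GRing.isLinear.Build R {poly R} R _ (umbral b M) umbral_is_scalar.

Lemma umbralXn m : (m < M)%N -> umbral b M 'X^m = b m.
Proof.
move=> mM; rewrite /umbral (bigD1 (Ordinal mM)) //= coefXn eqxx mul1r big1 ?addr0 // => i.
by rewrite -val_eqE /= coefXn => /negPf->; rewrite mul0r.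
Qed.

Lemma umbralXDCn (c : R) m : (m < M)%N ->
  umbral b M (('X + c%:P) ^+ m) = \sum_(s < m.+1) 'C(m, s)%:R * c ^+ (m - s) * b s.
Proof.
move=> mM; rewrite addrC exprDn linear_sum; apply: eq_bigr => s _.
rewrite -polyC_exp mul_polyC linearMn linearZ /= umbralXn; last first.
  by rewrite (leq_trans _ mM).
by rewrite -mulrA mulr_natl.
Qed.

(** By linearity only [q = 'X^i] matters: in the binomial expansion of [('X + 1) ^+ i] the top term
    gives [b i], and the lower ones add up to the derivative term by the hypothesis at
    [m = i - 1]. *)
Lemma umbral_shift (x : R) (q : {poly R}) :
  (forall m, \sum_(s < m.+1) 'C(m.+1, s)%:R * b s = m.+1%:R * x ^+ m) ->
  (size q <= M)%N ->
  umbral b M (q \Po ('X + 1)) = umbral b M q + q^`().[x].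
Proof.
move=> bE qM; rewrite comp_polyE -[in RHS](coefK q) poly_def.
rewrite !linear_sum horner_sum -big_split; apply: eq_bigr => i _ /=.
have iM := leq_trans (ltn_ord i) qM.
rewrite derivZ derivXn hornerZ hornerMn hornerXn !linearZ /= -mulrDr.
congr (_ * _); rewrite -polyC1 umbralXDCn // umbralXn // big_ord_recr /=.
rewrite binn subnn mulr1 mul1r.
(* For [i = 0] there is no predecessor, but the lower terms and the derivative both vanish. *)
rewrite addrC; congr (_ + _); case: {+}(i : nat) => [|m]; first by rewrite big_ord0 mulr0n.
by rewrite -mulr_natl -bE; apply: eq_bigr => s _; rewrite expr1n mulr1.
Qed.
End Umbral.

Lemma bernoulli_rec (F : numFieldType) (m : nat) :
  \sum_(s < m.+1) 'C(m.+1, s)%:R *: bernoulli F s = m.+1%:R *: 'X^m.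
Proof.
have fact_unit k : k`!%:R != 0 :> F by rewrite pnatr_eq0 -lt0n fact_gt0.
have /bernoulli_gfE/(_ m) := bernoulliP F; rewrite /fps_exp /fps_egf.
move/(congr1 (fun q => m.+1`!%:R *: q)); rewrite scalerA factS natrM mulfK // => <-.
(* The generating function lists the terms as [m - i], so the sum over [s] is reversed; the
   factorials then combine into ['C(m.+1, m - i)]. *)
rewrite scaler_sumr (reindex_inj rev_ord_inj) /=; apply: eq_bigr => i _.
have im : (i <= m)%N by rewrite -ltnS.
rewrite !scalerA subSS; congr (_ *: _).
rewrite -natrM -factS -(@bin_fact m.+1 (m - i)) ?(leq_trans (leq_subr _ _)) //.
by rewrite subSn ?leq_subr // subKn // mulnA natrM mulfK // natrM mulfK.
Qed.

Lemma arith_power_sum_bernoulli (F : numFieldType) (x : F) (n p : nat) :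
  p.+1%:R * \sum_(s < n) (x + s%:R) ^+ p =
  \sum_(s < p.+1) 'C(p.+1, s)%:R * n%:R ^+ (p.+1 - s) * (bernoulli F s).[x].
Proof.
pose b s := (bernoulli F s).[x].
have bE m : \sum_(s < m.+1) 'C(m.+1, s)%:R * b s = m.+1%:R * x ^+ m.
  have := congr1 (horner^~ x) (bernoulli_rec F m).
  rewrite horner_sum hornerZ hornerXn => <-.
  by apply: eq_bigr => s _; rewrite hornerZ.
(* The polynomials here have degree [p.+1], so the bound [p.+2] truncates nothing. *)
have step k : umbral b p.+2 (('X + k.+1%:R%:P) ^+ p.+1) =
    umbral b p.+2 (('X + k%:R%:P) ^+ p.+1) + p.+1%:R * (x + k%:R) ^+ p.
  have := @umbral_shift _ b p.+2 x (('X + k%:R%:P) ^+ p.+1) bE.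
  have := size_poly_exp_leq ('X + k%:R%:P : {poly F}) p.+1.
  rewrite size_XaddC mul1n => sz /(_ sz).
  rewrite rmorphXn /= comp_polyD comp_polyX comp_polyC -addrA -polyC1 -polyCD.
  rewrite -natr1 [1 + _]addrC => ->.
  by rewrite deriv_exp derivD derivX derivC addr0 mul1r hornerMn horner_exp !hornerE mulr_natl.
have tele k : umbral b p.+2 (('X + k%:R%:P) ^+ p.+1) =
    b p.+1 + p.+1%:R * \sum_(s < k) (x + s%:R) ^+ p.
  elim: k => [|k IHk]; last by rewrite step IHk big_ord_recr /= mulrDr addrA.
  by rewrite big_ord0 mulr0 !addr0 umbralXn.
(* The added [b p.+1] is the top term [s = p.+1] of the binomial expansion, which is absent from the
   claimed sum. *)
apply: (addrI (b p.+1)); rewrite -tele umbralXDCn // big_ord_recr /= addrC.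
by rewrite binn subnn mulr1 mul1r.
Qed.

Theorem theorem2 (R : realType) (n p : nat) (a d : R[i]) (hd : d != 0) :
  arith_power_sum p a d n =
  d ^+ p / p.+1%:R *
  \sum_(s < p.+1)
     'C(p.+1, s)%:R * n.+1%:R ^+ (p.+1 - s) * (bernoulli R[i] s).[a / d].
Proof.
rewrite -arith_power_sum_bernoulli mulrA divfK ?pnatr_eq0 // mulr_sumr.
(* Homogeneity: [a + s * d = d * (a / d + s)], which reduces the progression to step 1. *)
by apply: eq_bigr => s _; rewrite -exprMn mulrDr mulrCA divff // mulr1 [d * _]mulrC.
Qed.
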